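(* Let $f(z)=1+\sum_{n=1}^{\infty}a_{n}z^{n}$ and $g(z)=1+\sum_{n=1}^{\infty}b_{n}z^{n}$ be (formal) power series with real coefficients such that $g(z)=1/f(-z)$. For any positive integer $r$, the Toeplitz matrix $T[f]$ is totally positive up to level $r$ if and only if the Toeplitz matrix $T[g]$ is totally positive up to order $r$.
   Context: For a power series $f(z)=\sum_{n=0}^{\infty}a_{n}z^{n}$ with real coefficients, the Toeplitz matrix $T[f]$ is the infinite matrix indexed by pairs of integers $(i,j)\in\mathbb{Z}\times\mathbb{Z}$ with entries $T[f]_{ij}=a_{j-i}$ if $j-i\geq 0$ and $T[f]_{ij}=0$ if $j-i<0$. A minor of order $k$ ($k\ge 1$) of $T[f]$ is the determinant of the $k\times k$ submatrix $M$ supported on rows $i_1<i_2<\cdots<i_k$ and columns $j_1<j_2<\cdots<j_k$ (integers). The level of this submatrix, and of the corresponding minor, is the integer $\ell:=j_k-i_1+1-k$. The matrix $T[f]$ is totally positive up to order $r$ when every minor of $T[f]$ of order at most $r$ is nonnegative. The matrix $T[f]$ is totally positive up to level $r$ when every minor of $T[f]$ (of any order) of level at most $r$ is nonnegative. *)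

(* Defs.v *)
From mathcomp Require Import all_boot all_order all_algebra reals.

Set Implicit Arguments.
Unset Strict Implicit.
Unset Printing Implicit Defensive.

Import Order.TTheory GRing.Theory Num.Theory.
Local Open Scope ring_scope.

(* A formal power series is identified with its coefficient sequence. *)
Definition fps (R : nzRingType) := nat -> R.

Definition fps_one (R : nzRingType) : fps R := fun n => (n == 0)%N%:R.

Definition fps_mul (R : nzRingType) (f g : fps R) : fps R :=
  fun n => \sum_(i < n.+1) f i * g (n - i)%N.

(* f(-z) *)
Definition fps_subN (R : nzRingType) (f : fps R) : fps R :=
  fun n => (-1) ^+ n * f n.

(* g = 1/h *)
Definition fps_is_inv (R : nzRingType) (g h : fps R) : Prop :=
  fps_mul g h =1 @fps_one R.

Definition toeplitz (R : nzRingType) (f : fps R) (i j : int) : R :=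
  if 0 <= j - i then f `|j - i|%N else 0.

Definition strictly_increasing (k : nat) (i : 'I_k -> int) : Prop :=
  forall s t : 'I_k, (s < t)%N -> i s < i t.

Definition minor (R : comNzRingType) (M : int -> int -> R) (k : nat)
    (i j : 'I_k -> int) : R :=
  \det (\matrix_(s < k, t < k) M (i s) (j t)).

(* Since the order of a minor is at least 1, it is written k.+1; the first row
   index is then i ord0 and the last column index is j ord_max.  The level is
   an integer and may be negative. *)
Definition level (k : nat) (i j : 'I_k.+1 -> int) : int :=
  j ord_max - i ord0 + 1 - k.+1%:Z.

Definition tp_up_to_order (R : realType) (M : int -> int -> R) (r : nat) : Prop :=
  forall (k : nat) (i j : 'I_k.+1 -> int),
    strictly_increasing i -> strictly_increasing j ->
    (k.+1 <= r)%N -> 0 <= minor M i j.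

Definition tp_up_to_level (R : realType) (M : int -> int -> R) (r : nat) : Prop :=
  forall (k : nat) (i j : 'I_k.+1 -> int),
    strictly_increasing i -> strictly_increasing j ->
    level i j <= r%:Z -> 0 <= minor M i j.

(* Main.v *)
(* On an interval of n consecutive integers, T[f] restricts to a unitriangular
   matrix whose inverse has entries (-1)^(x+y) T[g]_{xy}.  Jacobi's identity for
   complementary minors then gives T[f]_{I,J} = T[g]_{J',I'}, where ' is the
   complement in the interval: the sign from Jacobi's identity cancels the signs
   of the inverse.  A minor of T[f] of level l that is not trivially zero lies in
   the interval [i_1, j_k], of size l + k, and so corresponds to a minor of T[g]
   of order l.  Conversely a minor of T[g] of order k, taken in any interval,
   corresponds to a minor of T[f] of level at most k. *)
Require Import Defs.
From mathcomp Require Import all_boot all_order all_algebra reals.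
From mathcomp Require Import zify ring.

Set Implicit Arguments.
Unset Strict Implicit.
Unset Printing Implicit Defensive.

Import Order.TTheory GRing.Theory Num.Theory.
Local Open Scope ring_scope.

(** * Increasing index maps and the sign of a shuffle *)

Lemma increasing_gap n (i : 'I_n -> nat) :
  (forall s t : 'I_n, (s < t)%N -> (i s < i t)%N) ->
  forall s t : 'I_n, (s <= t)%N -> (i s + (t - s) <= i t)%N.
Proof.
move=> inc s [t lt_tn] /=; elim: t lt_tn => [|t IHt] lt_tn le_st.
  have -> : s = Ordinal lt_tn by apply: val_inj => /=; lia.
  by lia.
have [eq_st|ne_st] := eqVneq (s : nat) t.+1.
  have -> : s = Ordinal lt_tn by exact: val_inj.
  by rewrite /=; lia.
have lt_tn' : (t < n)%N by lia.
have /IHt : (s <= t)%N by lia.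
move=> /(_ lt_tn'); have := inc (Ordinal lt_tn') (Ordinal lt_tn) (ltnSn _).
by lia.
Qed.

(** The gap from the first index to [s] gives [s <= i s], and the gap from [s] to the last index
    gives [i s <= s]. *)
Lemma increasing_ord_id n (i : 'I_n -> 'I_n) :
  (forall s t : 'I_n, (s < t)%N -> (i s < i t)%N) -> i =1 id.
Proof.
case: n i => [|n] i inc s; first by case: s.
have gap := @increasing_gap _ (fun s => i s : nat) inc.
apply: val_inj => /=; have := gap ord0 s; have := gap s ord_max.
have := ltn_ord s; have := ltn_ord (i ord_max); rewrite /=; lia.
Qed.

Section Shuffle.
Variable R : comNzRingType.

(** Induction on [k]: the first row has a single nonzero entry, in column [sigma ord0], and deleting
    its row and column leaves the matrix of a shuffle whose first block is one shorter. *)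
Lemma det_rowsub1_shuffle k l (sigma : 'I_(k + l) -> 'I_(k + l)) :
    injective sigma ->
    (forall s t : 'I_(k + l), (s < t < k)%N -> (sigma s < sigma t)%N) ->
    (forall s t : 'I_(k + l), (k <= s < t)%N -> (sigma s < sigma t)%N) ->
  \det (rowsub sigma (1%:M : 'M[R]_(k + l)))
    = (-1) ^+ (\sum_(s < k) (sigma (lshift l s) + s)).
Proof.
elim: k sigma => [|k IHk] sigma sigma_inj incl incr.
  rewrite big_ord0 expr0 -[RHS](det1 R l); congr (\det _).
  apply/matrixP => x y; rewrite !mxE.
  by rewrite (increasing_ord_id (i := sigma)) // => s t; apply: incr.
set v := sigma ord0.
(* The map [sigma] with the index 0 and its value [v] removed; since [sigma] is injective, the
   default [x] is never taken. *)
pose sigma' (x : 'I_(k + l)) := odflt x (unlift v (sigma (lift ord0 x))).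
have lift_sigma' x : lift v (sigma' x) = sigma (lift ord0 x).
  rewrite /sigma'; case: unliftP => [y -> //|/sigma_inj/eqP].
  by rewrite eq_sym (negPf (neq_lift _ _)).
have val_sigma' x : sigma (lift ord0 x) = bump v (sigma' x) :> nat.
  by rewrite -lift_sigma'.
have bump_lt a b : (bump v a < bump v b)%N -> (a < b)%N.
  by rewrite /bump; lia.
have lift0 (x : 'I_(k + l)) : lift ord0 x = x.+1 :> nat by [].
rewrite (expand_det_row _ ord0) (bigD1 v) //= big1 ?addr0; last first.
  by move=> y neq_yv; rewrite !mxE eq_sym (negPf neq_yv) mul0r.
rewrite !mxE eqxx mul1r /cofactor add0n.
set M := row' _ _.
have -> : M = rowsub sigma' 1%:M.
  by apply/matrixP => x y; rewrite !mxE -lift_sigma' (inj_eq lift_inj).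
rewrite IHk; last 3 first.
- move=> x y eq_xy; apply: (@lift_inj _ ord0); apply: sigma_inj.
  by rewrite -!lift_sigma' eq_xy.
- move=> s t lt_st; apply: bump_lt; rewrite -!val_sigma'; apply: incl.
  by rewrite !lift0.
- move=> s t lt_st; apply: bump_lt; rewrite -!val_sigma'; apply: incr.
  by rewrite !lift0.
rewrite big_ord_recl -exprD.
(* Deleting index 0 and its value v, the smallest of the first block, lowers the
   other positions and values of this block by one each, so the exponent keeps
   its parity up to v. *)
have -> : (\sum_(i < k) (sigma (lshift l (lift ord0 i)) + lift ord0 i)
        = \sum_(s < k) (sigma' (lshift l s) + s) + k.*2)%N.
  rewrite -muln2 -[k in (k * 2)%N]card_ord -sum_nat_const -big_split /=.
  apply: eq_bigr => s _.
  have -> : lshift l (lift ord0 s) = lift ord0 (lshift l s) by exact: val_inj.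
  have : (sigma ord0 < sigma (lift ord0 (lshift l s)))%N.
    by apply: incl; rewrite lift0 /= ltnS ltn_ord.
  by rewrite val_sigma' -/v /bump /= /bump; lia.
have -> : lshift l (ord0 : 'I_k.+1) = ord0 by exact: val_inj.
by rewrite -[LHS]signr_odd -[RHS]signr_odd -/v /= !addn0 !oddD odd_double addbF.
Qed.

End Shuffle.

(** * Complementary minors of inverse matrices *)

(** Jacobi's identity for the leading block, where no sign occurs; the general case reduces to it by
    reordering rows and columns. *)
Lemma det_ulsubmx_inv (R : comNzRingType) k l (A B : 'M[R]_(k + l)) :
  A *m B = 1%:M -> \det (ulsubmx A) = \det A * \det (drsubmx B).
Proof.
move=> AB1.
have [eq12 eq22] :
    ulsubmx A *m ursubmx B + ursubmx A *m drsubmx B = 0 /\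
    dlsubmx A *m ursubmx B + drsubmx A *m drsubmx B = 1%:M.
  move: AB1; rewrite -{1}[A]submxK -{1}[B]submxK mulmx_block scalar_mx_block.
  by move=> /eq_block_mx[].
(* Replacing the left block column of B by that of 1 makes the product
   block triangular. *)
have : A *m block_mx 1%:M (ursubmx B) 0 (drsubmx B)
     = block_mx (ulsubmx A) 0 (dlsubmx A) 1%:M.
  rewrite -{1}[A]submxK mulmx_block !mulmx1 !mulmx0 !addr0.
  by rewrite eq12 eq22.
move/(congr1 determinant); rewrite det_mulmx det_ublock det_lblock !det1.
by rewrite mul1r mulr1.
Qed.

Lemma det_mxsub (R : comNzRingType) n (s t : 'I_n -> 'I_n) (A : 'M[R]_n) :
  \det (mxsub s t A)
    = \det (rowsub s 1%:M : 'M[R]_n) * \det A * \det (rowsub t 1%:M : 'M[R]_n).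
Proof.
rewrite -[\det (rowsub t _)]det_tr -!det_mulmx trmx_mxsub trmx1; congr (\det _).
rewrite mul_rowsub_mx mul1mx mulmx_colsub mulmx1.
by apply/matrixP => x y; rewrite !mxE.
Qed.

(** For complementary index sets with [n = k + l] this is a permutation, and reordering by it moves
    the rows or columns chosen by [i] to the front. *)
Definition shuffle k l n (i : 'I_k -> 'I_n) (i' : 'I_l -> 'I_n)
    (x : 'I_(k + l)) : 'I_n :=
  match split x with inl s => i s | inr t => i' t end.

Lemma shuffle_lshift k l n (i : 'I_k -> 'I_n) (i' : 'I_l -> 'I_n) s :
  shuffle i i' (lshift l s) = i s.
Proof. by rewrite /shuffle -/(unsplit (inl s)) unsplitK. Qed.

Lemma shuffle_rshift k l n (i : 'I_k -> 'I_n) (i' : 'I_l -> 'I_n) t :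
  shuffle i i' (rshift k t) = i' t.
Proof. by rewrite /shuffle -/(unsplit (inr t)) unsplitK. Qed.

Definition shuffleE := (shuffle_lshift, shuffle_rshift).

Definition ord_increasing k n (i : 'I_k -> 'I_n) :=
  forall s t : 'I_k, (s < t)%N -> (i s < i t)%N.

Lemma ord_increasing_inj k n (i : 'I_k -> 'I_n) :
  ord_increasing i -> injective i.
Proof.
move=> inc s t eq_st; apply: val_inj => /=.
by case: (ltngtP s t) => // /inc; rewrite eq_st ltnn.
Qed.

Section ComplementaryPair.
Variables (k l : nat) (i : 'I_k -> 'I_(k + l)) (i' : 'I_l -> 'I_(k + l)).
Hypotheses (inc : ord_increasing i) (inc' : ord_increasing i').
Hypothesis disj : forall s t, i s != i' t.

Lemma shuffle_inj : injective (shuffle i i').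
Proof.
move=> x y; case: (split_ordP x) => s ->; case: (split_ordP y) => t ->;
  rewrite !shuffleE.
- by move/(ord_increasing_inj inc) ->.
- by move/eqP; rewrite (negPf (disj _ _)).
- by move/eqP; rewrite eq_sym (negPf (disj _ _)).
- by move/(ord_increasing_inj inc') ->.
Qed.

Lemma det_shuffle (R : comNzRingType) :
  \det (rowsub (shuffle i i') 1%:M : 'M[R]_(k + l))
    = (-1) ^+ (\sum_(s < k) (i s + s)).
Proof.
rewrite det_rowsub1_shuffle; first 1 last.
- exact: shuffle_inj.
- move=> x y; case: (split_ordP x) => s ->; case: (split_ordP y) => t -> /=;
    rewrite !shuffleE; try (have := ltn_ord t; lia).
  by case/andP => /inc.
- move=> x y; case: (split_ordP x) => s ->; case: (split_ordP y) => t -> /=;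
    rewrite !shuffleE; try (move: (ltn_ord s) (ltn_ord t); lia).
  by rewrite ltn_add2l => /andP[_ /inc'].
by under eq_bigr do rewrite shuffleE.
Qed.

Lemma sum_complementary :
  (\sum_(s < k) i s + \sum_(t < l) i' t = \sum_(x < k + l) x)%N.
Proof.
rewrite [RHS](reindex_inj shuffle_inj) big_split_ord /=.
by congr (_ + _)%N; apply: eq_bigr => s _; rewrite shuffleE.
Qed.

End ComplementaryPair.

Lemma complement_exists k l (i : 'I_k -> 'I_(k + l)) :
  ord_increasing i ->
  exists2 i' : 'I_l -> 'I_(k + l),
    ord_increasing i' & forall s t, i s != i' t.
Proof.
move=> inc; pose A := ~: [set i s | s in setT].
have cardA : #|A| = l.
  have := cardsC [set i s | s in setT].
  rewrite card_imset ?cardsT ?card_ord; last exact: ord_increasing_inj.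
  exact: addnI.
pose i' t := enum_val (cast_ord (esym cardA) t).
exists i' => [s t lt_st|s t]; last first.
  have : i' t \in A by exact: enum_valP.
  rewrite inE.
  by apply: contraNneq => <-; rewrite imset_f.
(* The enumeration of [A] is a filter of the ordered list of all ordinals, so it is increasing. *)
have sortedA : sorted (relpre val ltn) (enum A).
  rewrite /enum_mem -enumT sorted_filter //; first by move=> ? ? ?; apply: ltn_trans.
  by rewrite -sorted_map val_enum_ord iota_ltn_sorted.
rewrite /i' !(enum_val_nth (i' s)).
by apply: (sorted_ltn_nth _ _ sortedA); rewrite ?inE -?cardE ?cardA //;
  move=> ? ? ?; apply: ltn_trans.
Qed.

Section Jacobi.
Variables (R : comNzRingType) (k l : nat).
Variables (i j : 'I_k -> 'I_(k + l)) (i' j' : 'I_l -> 'I_(k + l)).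
Hypotheses (inci : ord_increasing i) (inci' : ord_increasing i').
Hypotheses (incj : ord_increasing j) (incj' : ord_increasing j').
Hypotheses (disji : forall s t, i s != i' t) (disjj : forall s t, j s != j' t).

(** Reordering the rows of [A] and columns of [B] by one shuffle, and the columns of [A] and rows of
    [B] by the other, keeps them inverse and brings the chosen minors to opposite diagonal
    corners. *)
Lemma det_mxsub_inv_complement (A B : 'M[R]_(k + l)) :
  A *m B = 1%:M ->
  \det (mxsub i j A) = (-1) ^+ (\sum_(s < k) i s + \sum_(s < k) j s)
    * \det A * \det (mxsub j' i' B).
Proof.
move=> AB1; pose s := shuffle i i'; pose t := shuffle j j'.
have s_inj : injective s by exact: shuffle_inj.
have t_inj : injective t by exact: shuffle_inj.
have ABst : mxsub s t A *m mxsub t s B = 1%:M.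
  apply/matrixP => x y; rewrite !mxE.
  have /matrixP/(_ (s x) (s y)) := AB1; rewrite !mxE (inj_eq s_inj) => <-.
  rewrite [RHS](reindex_inj t_inj); apply: eq_bigr => z _.
  by rewrite !mxE.
have := det_ulsubmx_inv ABst.
have -> : ulsubmx (mxsub s t A) = mxsub i j A.
  by apply/matrixP => x y; rewrite !mxE /s /t !shuffleE.
have -> : drsubmx (mxsub t s B) = mxsub j' i' B.
  by apply/matrixP => x y; rewrite !mxE /s /t !shuffleE.
move=> ->; rewrite det_mxsub !det_shuffle // !big_split !exprD /=.
(* Each of the two shuffle signs contains the factor [e], so it cancels. *)
set e := (-1) ^+ (\sum_(s < k) s).
have ee1 : e * e = 1 by rewrite /e -expr2 sqrr_sign.
ring: ee1.
Qed.

End Jacobi.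

(** * Finite windows of Toeplitz matrices *)

Definition toeplitz_window (R : nzRingType) (f : fps R) n : 'M[R]_n :=
  \matrix_(x < n, y < n) toeplitz f x%:Z y%:Z.

Lemma toeplitz_nat (R : nzRingType) (f : fps R) (x y : nat) :
  toeplitz f x%:Z y%:Z = if (x <= y)%N then f (y - x)%N else 0.
Proof.
rewrite /toeplitz subr_ge0 lez_nat; case: leqP => // le_xy.
by congr f; lia.
Qed.

(** Translation invariance allows every window of consecutive integers to be moved to start at 0. *)
Lemma toeplitz_shift (R : nzRingType) (f : fps R) (w x y : int) :
  toeplitz f (w + x) (w + y) = toeplitz f x y.
Proof. by rewrite /toeplitz opprD addrACA subrr add0r. Qed.

Lemma det_toeplitz_window (R : comNzRingType) (f : fps R) n :
  f 0%N = 1 -> \det (toeplitz_window f n) = 1.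
Proof.
move=> f0; rewrite -det_tr det_trig.
  by apply: big1 => x _; rewrite !mxE toeplitz_nat leqnn subnn f0.
apply/is_trig_mxP => x y lt_xy.
by rewrite !mxE toeplitz_nat leqNgt lt_xy.
Qed.

Section Toeplitz.
Variables (R : comNzRingType) (f g : fps R).
Hypotheses (f0 : f 0%N = 1) (gf : fps_is_inv g (fps_subN f)).

Lemma toeplitz_window_inv n :
  toeplitz_window f n
    *m (\matrix_(x, y) ((-1) ^+ (x + y) * toeplitz_window g n x y)) = 1%:M.
Proof.
(* In the reverse order, the entry at [(x, y)] is, up to sign, the coefficient of degree [y - x] in
   the product of [g] and f(-z), as in [gf]. *)
apply: mulmx1C; apply/matrixP => x y; rewrite !mxE.
pose H (z : nat) := (-1) ^+ (x + z) * toeplitz g x%:Z z%:Z * toeplitz f z%:Z y%:Z.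
transitivity (\sum_(0 <= z < n) H z).
  by rewrite big_mkord; apply: eq_bigr => z _; rewrite !mxE.
have [lt_yx|le_xy] := ltnP y x.
  have /negPf-> : x != y by apply: contraTneq lt_yx => ->; rewrite ltnn.
  rewrite big1 // => z _; rewrite /H !toeplitz_nat.
  case: leqP => le_xz; last by rewrite mulr0 mul0r.
  by case: leqP => le_zy; rewrite ?mulr0 //; lia.
(* Only the range from [x] to [y] contributes: below [x] the factor from [g] vanishes, above [y] the
   one from [f]. *)
rewrite (@big_cat_nat _ _ _ x) ?(ltnW (ltn_ord x)) //=.
rewrite [X in _ + X](@big_cat_nat _ _ _ y.+1) ?ltn_ord ?(leqW le_xy) //=.
rewrite [X in X + _]big_nat_cond [X in X + _]big1 ?add0r; last first.
  move=> z; rewrite andbT => /andP[_ lt_zx].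
  by rewrite /H !toeplitz_nat leqNgt lt_zx mulr0 mul0r.
rewrite [X in _ + X]big_nat_cond [X in _ + X]big1 ?addr0; last first.
  move=> z; rewrite andbT => /andP[lt_yz _].
  by rewrite /H !toeplitz_nat [(z <= y)%N]leqNgt lt_yz mulr0.
rewrite -{1}[nat_of_ord x]add0n big_addn subSn // big_mkord.
have := gf (y - x)%N; rewrite /fps_mul /fps_subN /fps_one => gfxy.
transitivity ((-1) ^+ (y - x) * ((y - x)%N == 0%N)%:R : R); last first.
  have -> : (x == y) = ((y - x)%N == 0%N).
    by rewrite -val_eqE /= subn_eq0 eqn_leq le_xy.
  by case: eqP => [->|_]; rewrite ?mul1r ?mulr0.
rewrite -gfxy big_distrr /=; apply: eq_bigr => z _.
have := ltn_ord z; rewrite /H !toeplitz_nat ltnS => le_z.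
have -> : (x <= z + x)%N by lia.
have -> : (z + x <= y)%N by lia.
have -> : (z + x - x = z)%N by lia.
have -> : (y - (z + x) = y - x - z)%N by lia.
have -> : (x + (z + x) = x.*2 + z)%N by lia.
rewrite exprD -[(-1) ^+ x.*2]signr_odd odd_double expr0 mul1r.
(* This moves the sign from the coefficient of [g] to that of [f], as f(-z) requires, at the cost of
   a factor independent of [z]. *)
have -> : (-1) ^+ z = (-1) ^+ (y - x) * (-1) ^+ (y - x - z) :> R.
  rewrite -exprD -[LHS]signr_odd -[RHS]signr_odd; congr (_ ^+ nat_of_bool _).
  by move: le_z; lia.
by ring.
Qed.

Lemma det_mxsub_toeplitz_complement k l
    (i j : 'I_k -> 'I_(k + l)) (i' j' : 'I_l -> 'I_(k + l)) :
    ord_increasing i -> ord_increasing i' ->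
    ord_increasing j -> ord_increasing j' ->
    (forall s t, i s != i' t) -> (forall s t, j s != j' t) ->
  \det (mxsub i j (toeplitz_window f (k + l)))
    = \det (mxsub j' i' (toeplitz_window g (k + l))).
Proof.
move=> inci inci' incj incj' disji disjj.
rewrite (det_mxsub_inv_complement inci inci' incj incj' disji disjj
  (toeplitz_window_inv _)) det_toeplitz_window // mulr1.
set T := toeplitz_window g _.
(* The checkerboard signs split into a row factor and a column factor, hence into two diagonal
   matrices. *)
have -> : mxsub j' i' (\matrix_(x, y) ((-1) ^+ (x + y) * T x y))
    = diag_mx (\row_t (-1) ^+ j' t) *m mxsub j' i' T
      *m diag_mx (\row_t (-1) ^+ i' t).
  apply/matrixP => x y; rewrite mul_mx_diag mul_diag_mx !mxE exprD.
  by ring.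
rewrite !det_mulmx !det_diag.
under [X in _ * (X * _ * _)]eq_bigr do rewrite mxE.
under [X in _ * (_ * X)]eq_bigr do rewrite mxE.
rewrite !prodrXr mulrAC mulrA -!exprD mulrC.
(* The exponent is the sum of all four index families, which is twice the sum of all indices of the
   window, hence even. *)
have := sum_complementary inci inci' disji.
have := sum_complementary incj incj' disjj.
move: (\sum_(s < k) _)%N (\sum_(s < k) _)%N => a b.
move=> sumj sumi; rewrite [X in (a + b + X)%N]addnC addnACA sumi sumj.
by rewrite -signr_odd addnn odd_double mulr1.
Qed.

End Toeplitz.

(** * Passage between integer indices and windows *)

Lemma int_window k n (w : int) (i : 'I_k -> int) :
    strictly_increasing i -> (forall s, w <= i s < w + n%:Z) ->
  exists2 i0 : 'I_k -> 'I_n, ord_increasing i0 & forall s, i s = w + (i0 s)%:Z.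
Proof.
move=> inc bnd; have lt s : (`|i s - w| < n)%N by move: (bnd s); lia.
exists (fun s => Ordinal (lt s)) => [s t /inc|s] /=.
  by move: (bnd s) (bnd t); lia.
by move: (bnd s); lia.
Qed.

Lemma strictly_increasing_shift k n (w : int) (i : 'I_k -> 'I_n) :
  ord_increasing i -> strictly_increasing (fun s => w + (i s)%:Z).
Proof. by move=> inc s t /inc; lia. Qed.

Lemma strictly_increasing_le k (i : 'I_k -> int) :
  strictly_increasing i -> forall s t : 'I_k, (s <= t)%N -> i s <= i t.
Proof.
move=> inc s t; rewrite leq_eqVlt => /predU1P[/val_inj -> //|/inc /ltW //].
Qed.

Lemma minor_toeplitz_window (R : comNzRingType) (f : fps R) k n (w : int)
    (i j : 'I_k -> 'I_n) (i1 j1 : 'I_k -> int) :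
    (forall s, i1 s = w + (i s)%:Z) -> (forall s, j1 s = w + (j s)%:Z) ->
  minor (toeplitz f) i1 j1 = \det (mxsub i j (toeplitz_window f n)).
Proof.
move=> ei ej; congr (\det _); apply/matrixP => x y.
by rewrite !mxE ei ej toeplitz_shift.
Qed.

(** * The two implications between level and order *)

Section Levels.
Variables (R : realType) (f g : fps R).
Hypotheses (f0 : f 0%N = 1) (gf : fps_is_inv g (fps_subN f)).

Lemma tp_level_order r :
  tp_up_to_level (toeplitz f) r -> tp_up_to_order (toeplitz g) r.
Proof.
move=> tpf k i j inci incj le_kr.
pose w : int := Order.min (i ord0) (j ord0).
(* Any window containing both families would do; the size [l.+1 + k.+1] leaves a complement of
   [l.+1] indices, so that the minor of [f] has order at least 1. *)
pose l := (`|i ord_max - w| + `|j ord_max - w|)%N.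
have bndi s : w <= i s < w + (l.+1 + k.+1)%:Z.
  have := @strictly_increasing_le _ _ inci ord0 _ (leq0n s).
  have := @strictly_increasing_le _ _ inci _ ord_max (leq_ord s).
  by rewrite /l /w; lia.
have bndj s : w <= j s < w + (l.+1 + k.+1)%:Z.
  have := @strictly_increasing_le _ _ incj ord0 _ (leq0n s).
  have := @strictly_increasing_le _ _ incj _ ord_max (leq_ord s).
  by rewrite /l /w; lia.
have [i0 inci0 ei] := int_window inci bndi.
have [j0 incj0 ej] := int_window incj bndj.
have := @complement_exists k.+1 l.+1; rewrite addnC => compl.
have [i' inci' disji] := compl _ inci0.
have [j' incj' disjj] := compl _ incj0.
rewrite (minor_toeplitz_window g ei ej).
rewrite -(@det_mxsub_toeplitz_complement _ f g f0 gf _ _ j' i' j0 i0) //;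
  try by move=> s t; rewrite eq_sym.
rewrite -(@minor_toeplitz_window _ f _ _ w _ _ (fun s => w + (j' s)%:Z)
  (fun s => w + (i' s)%:Z)) //.
apply: tpf; try exact: strictly_increasing_shift.
(* The last column lies at offset at most [l + k + 1] and the first row at offset at least 0, so a
   minor of order [l.+1] has level at most [k.+1]. *)
by rewrite /level; move: (ltn_ord (i' ord_max)); lia.
Qed.

Lemma tp_order_level r :
  tp_up_to_order (toeplitz g) r -> tp_up_to_level (toeplitz f) r.
Proof.
move=> tpg k i j inci incj; rewrite /level => le_lr.
(* Here the first column lies strictly below the diagonal and is zero; in the next case the last row
   is. *)
have [lt_ji|le_ij0] := ltP (j ord0) (i ord0).
  rewrite /minor (expand_det_col _ ord0) big1 // => s _.
  rewrite mxE /toeplitz ifF ?mul0r //.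
  by have := @strictly_increasing_le _ _ inci ord0 _ (leq0n s); lia.
have [lt_ji|le_ijm] := ltP (j ord_max) (i ord_max).
  rewrite /minor (expand_det_row _ ord_max) big1 // => s _.
  rewrite mxE /toeplitz ifF ?mul0r //.
  by have := @strictly_increasing_le _ _ incj _ ord_max (leq_ord s); lia.
set w := i ord0 in le_lr le_ij0.
have [n en] : exists n : nat, j ord_max = w + n%:Z.
  exists `|j ord_max - w|%N.
  by have := @strictly_increasing_le _ _ incj ord0 _ (leq0n ord_max); lia.
have bndi s : w <= i s < w + n.+1%:Z.
  have := @strictly_increasing_le _ _ inci ord0 _ (leq0n s).
  have := @strictly_increasing_le _ _ inci _ ord_max (leq_ord s).
  by rewrite -/w; lia.
have bndj s : w <= j s < w + n.+1%:Z.
  have := @strictly_increasing_le _ _ incj ord0 _ (leq0n s).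
  have := @strictly_increasing_le _ _ incj _ ord_max (leq_ord s).
  by lia.
have [i0 inci0 ei] := int_window inci bndi.
have [j0 incj0 ej] := int_window incj bndj.
have le_kn : (k <= n)%N.
  have := @increasing_gap _ (fun s => i0 s : nat) inci0 ord0 ord_max (leq0n _).
  by have /= := ltn_ord (i0 ord_max); lia.
(* The window runs exactly from the first row to the last column, so [l] is the level of the
   minor. *)
have [l en1] : exists l, n.+1 = (k.+1 + l)%N by exists (n - k)%N; lia.
move: i0 j0 inci0 incj0 ei ej; rewrite en1 => i0 j0 inci0 incj0 ei ej.
have [i' inci' disji] := complement_exists inci0.
have [j' incj' disjj] := complement_exists incj0.
rewrite (minor_toeplitz_window f ei ej).
rewrite (det_mxsub_toeplitz_complement f0 gf inci0 inci' incj0 incj') //.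
(* At level 0 the complement is empty and the minor equals the empty determinant 1; total positivity
   of [g] covers only orders at least 1. *)
case: l en1 i' j' inci' incj' {bndi bndj i0 j0 inci0 incj0 ei ej disji disjj}
  => [|l] en1 i' j' inci' incj'; first by rewrite det_mx00.
rewrite -(@minor_toeplitz_window _ g _ _ w _ _ (fun s => w + (j' s)%:Z)
  (fun s => w + (i' s)%:Z)) //.
by apply: tpg; try exact: strictly_increasing_shift; lia.
Qed.

End Levels.

Theorem theoremB (R : realType) (f g : fps R)
    (f0 : f 0%N = 1) (g0 : g 0%N = 1)
    (gf : fps_is_inv g (fps_subN f))
    (r : nat) (r_gt0 : (0 < r)%N) :
  tp_up_to_level (toeplitz f) r <-> tp_up_to_order (toeplitz g) r.
Proof. by split; [exact: tp_level_order | exact: tp_order_level]. Qed.
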